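(* Let $p\in[1,2)$ and for each $n\in\mathbb N$ let $X^{(n,p)}$ be uniformly distributed on $n^{1/p}\mathbb B_p^n$, where $\mathbb B_p^n=\{x\in\mathbb R^n:\sum_{i}|x_i|^p\le1\}$. Set $s_n:=n^{2p/(2+p)}$. Then $s_n\to\infty$, $n/s_n\to\infty$, and the sequence $\{\sqrt{s_n}\,\|X^{(n,p)}\|_2/n\}_{n\in\mathbb N}$ satisfies an LDP in $\mathbb R$ at speed $s_n$ with GRF $$J_{X,p}(x)=\begin{cases}x^p/p,&x\ge0,\\+\infty,&x<0.\end{cases}$$
   Context: $\|\cdot\|_2$ is the Euclidean norm. LDP: a sequence of random variables $\{\eta_n\}$ with values in a regular topological space $\mathcal X$ satisfies a large deviation principle (LDP) at speed $s_n$ (positive reals with $s_n\to\infty$) with rate function $I:\mathcal X\to[0,\infty]$ if $I$ is lower semicontinuous and for every Borel set $\Gamma$, $-\inf_{\Gamma^\circ}I\le\liminf_n\frac1{s_n}\log\mathbb P(\eta_n\in\Gamma)\le\limsup_n\frac1{s_n}\log\mathbb P(\eta_n\in\Gamma)\le-\inf_{\bar\Gamma}I$. It is a good rate function (GRF) if moreover its level sets are compact. *)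

(* Defs.v *)
From HB Require Import structures.
From mathcomp Require Import all_boot all_order all_algebra.
From mathcomp Require Import all_classical all_reals all_analysis.

Set Implicit Arguments.
Unset Strict Implicit.
Unset Printing Implicit Defensive.

Import Order.TTheory GRing.Theory Num.Theory.
Import numFieldNormedType.Exports.

Local Open Scope classical_set_scope.
Local Open Scope ring_scope.

(* R^n is [n.-tuple (measurableTypeR R)]; its measurable sets form the sigma-
   algebra generated by the coordinates, i.e. the Borel sets of R^n. *)

Section lebesgue_tuple.
Context {R : realType}.
Local Notation RT := (measurableTypeR R).
Local Open Scope ereal_scope.

Definition tuple_cons (n : nat) (u : RT * n.-tuple RT) : n.+1.-tuple RT :=
  [tuple of u.1 :: u.2].

Lemma measurable_tuple_cons (n : nat) : measurable_fun setT (@tuple_cons n).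
Proof. exact: measurable_cons. Qed.

Definition tuple_uncons (n : nat) (t : n.+1.-tuple RT) : RT * n.-tuple RT :=
  (thead t, [tuple of behead t]).

Lemma measurable_tuple_uncons (n : nat) :
  measurable_fun setT (@tuple_uncons n).
Proof.
apply/measurable_fun_pair; first exact: measurable_tnth.
exact: measurable_behead.
Qed.

Lemma tuple_consK (n : nat) : cancel (@tuple_cons n) (@tuple_uncons n).
Proof. by move=> [x t]; congr pair; exact: val_inj. Qed.

Section step.
Variables (n : nat) (m : {sigma_finite_measure set (n.-tuple RT) -> \bar R}).

Definition lebesgue_tupleS : set (n.+1.-tuple RT) -> \bar R :=
  pushforward ((@lebesgue_measure R) \x m) (@tuple_cons n).

Let mcons (A : set (n.+1.-tuple RT)) :
  measurable A -> measurable (@tuple_cons n @^-1` A).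
Proof.
by move=> mA; rewrite -[X in measurable X]setTI; exact: measurable_tuple_cons.
Qed.

Let lebesgue_tupleS0 : lebesgue_tupleS set0 = 0.
Proof. by rewrite /lebesgue_tupleS /pushforward preimage_set0 measure0. Qed.

Let lebesgue_tupleS_ge0 A : 0 <= lebesgue_tupleS A.
Proof. by rewrite /lebesgue_tupleS /pushforward measure_ge0. Qed.

Let lebesgue_tupleS_sigma_additive : semi_sigma_additive lebesgue_tupleS.
Proof.
move=> F mF tF mUF; rewrite /lebesgue_tupleS /pushforward preimage_bigcup.
apply: measure_semi_sigma_additive.
- by move=> i; exact: mcons.
- apply/trivIsetP => /= i j _ _ ij; rewrite -preimage_setI.
  by move/trivIsetP : tF => /(_ _ _ _ _ ij) ->//; rewrite preimage_set0.
- by rewrite -preimage_bigcup; apply: mcons.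
Qed.

HB.instance Definition _ := isMeasure.Build _ _ _ lebesgue_tupleS
  lebesgue_tupleS0 lebesgue_tupleS_ge0 lebesgue_tupleS_sigma_additive.

Let lebesgue_tupleS_sigma_finite : sigma_finite setT lebesgue_tupleS.
Proof.
have /sigma_finiteP[F [FT Fnd Foo]] := sigma_finiteT (@lebesgue_measure R).
have /sigma_finiteP[G [GT Gnd Goo]] := sigma_finiteT m.
exists (fun i => @tuple_uncons n @^-1` (F i `*` G i)).
  rewrite -preimage_bigcup (_ : \bigcup_i _ = setT) ?preimage_setT//.
  rewrite -subTset => -[x y] _.
  have [i _ Fx] : (\bigcup_i F i) x by rewrite -FT.
  have [j _ Gy] : (\bigcup_i G i) y by rewrite -GT.
  exists (maxn i j) => //; split => /=.
  - by move: x Fx; exact/subsetPset/Fnd/leq_maxl.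
  - by move: y Gy; exact/subsetPset/Gnd/leq_maxr.
move=> i; have [mF Fi] := Foo i; have [mG Gi] := Goo i; split.
  rewrite -[X in measurable X]setTI; apply: measurable_tuple_uncons => //.
  exact: measurableX.
rewrite /lebesgue_tupleS /pushforward -comp_preimage.
rewrite (_ : _ \o _ = id) ?preimage_id; last first.
  by apply/funext => u; exact: tuple_consK.
by rewrite product_measure1E// lte_mul_pinfty// ge0_fin_numE.
Qed.

HB.instance Definition _ := Measure_isSigmaFinite.Build _ _ _ lebesgue_tupleS
  lebesgue_tupleS_sigma_finite.

End step.

(* n-dimensional Lebesgue measure: the n-fold product of [lebesgue_measure]
   (the unit mass on the one-point space R^0 for n = 0). *)
Fixpoint lebesgue_tuple (n : nat) :
    {sigma_finite_measure set (n.-tuple RT) -> \bar R} :=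
  if n is n'.+1 then lebesgue_tupleS (lebesgue_tuple n')
  else @dirac _ (0.-tuple RT) [tuple] R.

End lebesgue_tuple.

Definition norm2 (R : realType) (n : nat) (x : n.-tuple (measurableTypeR R)) : R :=
  Num.sqrt (\sum_(i < n) (tnth x i : R) ^+ 2).

Definition lp_ball (R : realType) (p : R) (n : nat) :
    set (n.-tuple (measurableTypeR R)) :=
  [set x | \sum_(i < n) `|tnth x i : R| `^ p <= 1].
Arguments lp_ball {R} p n _.

Definition dilate (R : realType) (n : nat) (c : R)
    (A : set (n.-tuple (measurableTypeR R))) :
    set (n.-tuple (measurableTypeR R)) :=
  [set [tuple (c * tnth x i : R) | i < n] | x in A].

(* Total mass 1 of the law of X forces 0 < vol(K) < +oo. *)
Definition uniform_on (R : realType) (d : measure_display)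
    (T : measurableType d) (P : probability T R) (n : nat)
    (X : {RV P >-> n.-tuple (measurableTypeR R)})
    (K : set (n.-tuple (measurableTypeR R))) : Prop :=
  forall A, measurable A ->
    distribution P X A = (lebesgue_tuple n (A `&` K) / lebesgue_tuple n K)%E.

Section large_deviations.
Context {R : realType} {X : topologicalType}.
Local Open Scope ereal_scope.

Definition rate_function (I : X -> \bar R) : Prop :=
  (forall x, 0 <= I x) /\ lower_semicontinuous I.

Definition good_rate_function (I : X -> \bar R) : Prop :=
  rate_function I /\ forall a : R, compact [set x | I x <= a%:E].

(* Sequences indexed by n = 1, 2, ...: the term of index 0 is irrelevant. *)
Definition speed (s : R^nat) : Prop :=
  (forall n, (0 < n)%N -> (0 < s n)%R) /\ s @ \oo --> +oo%R.

(* The random elements may live on different probability spaces. The Borel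
   sets are those of [<<s open >>]; [lne 0 = -oo] and [ereal_inf set0 = +oo]. *)
Definition LDP (d : nat -> measure_display)
    (T : forall n, measurableType (d n)) (P : forall n, probability (T n) R)
    (eta : forall n, T n -> X) (s : R^nat) (I : X -> \bar R) : Prop :=
  [/\ forall n G, <<s [set U : set X | open U] >> G ->
        measurable (eta n @^-1` G),
      speed s,
      rate_function I &
      forall G, <<s [set U : set X | open U] >> G ->
        let u n := (s n)^-1%:E * lne (P n (eta n @^-1` G)) in
        [/\ - ereal_inf (I @` interior G) <= limn_einf u,
            limn_einf u <= limn_esup u &
            limn_esup u <= - ereal_inf (I @` closure G)]].

End large_deviations.

(* Main.v *)
Require Import Defs.
From mathcomp Require Import all_boot all_order all_algebra.
From mathcomp Require Import all_classical all_reals all_analysis.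
From mathcomp Require Import measurable_realfun ring lra.
Import Order.TTheory GRing.Theory Num.Theory.
Import numFieldNormedType.Exports.
Local Open Scope classical_set_scope.
Local Open Scope ring_scope.

Set Implicit Arguments.
Unset Strict Implicit.
Unset Printing Implicit Defensive.

(* Write N(x) for sum |x_i|^p, V_n(r) for the volume of {N <= r} and c for the
   integral of exp(-|x|^p/p) over R. Comparing the uniform measure on {N <= n}
   with the product density exp(-N/p) costs only a polynomial factor:
     c^n e^{n/p} / poly(n) <= V_n(n) <= c^n e^{n/p},
   the upper bound by Markov, the lower one by slicing R^n into the shells
   k < N <= k+1 and using the homogeneity V_n(a^p r) = a^n V_n(r).
   Upper tail: ||x||_2 >= T implies sum min(x_i^2, T^2) >= T^2, and the
   exponential moment of l min(x^2, T^2) with l = (1-e) T^{p-2} / p is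
   1 + O(l), whence a bound exp(-(1-e) T^p / p + O(n T^{p-2})).
   Lower tail: make one coordinate lie in (T, T+1] and use the volume bounds in
   dimension n-1. With T = x n / sqrt(s_n) one has T^p = x^p s_n, and all error
   terms are o(s_n) because p < 2. *)

(** * Product Lebesgue measure and the scaling of volumes of [l_p] balls *)

Section tuple_volume.
Context {R : realType}.
Local Notation RT := (measurableTypeR R).
Local Notation mu := (@lebesgue_measure R).
Implicit Types (p r k x : R) (n : nat).

(** Uniqueness of Lebesgue measure: [k] times its image under multiplication by [k] gives every
    half-open interval its length. *)
Lemma lebesgue_measure_scale k (A : set RT) : 0 < k -> measurable A ->
  mu ( *%R k @^-1` A) = (k^-1%:E * mu A)%E.
Proof.
move=> k0 mA.
have mk : measurable_fun [set: RT] ( *%R k : RT -> RT).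
  exact: mulrl_measurable.
pose nk := NngNum (ltW k0).
have /(_ mk A mA) -> : forall B, measurable B ->
    mu B = mscale nk (pushforward mu ( *%R k : RT -> RT)) B.
  move=> {}mk; apply: lebesgue_measure_unique => _ [[a b]] _ <-.
  transitivity (k%:E * mu `](a / k)%R, (b / k)%R])%E; last first.
    congr (_ * mu _)%E; apply/seteqP.
    by split=> y /=; rewrite !in_itv/= ltr_pdivrMr// ler_pdivlMr// ![y * k]mulrC.
  rewrite !lebesgue_measure_itv/= !lte_fin ltr_pM2r ?invr_gt0//.
  case: ifPn => _; last by rewrite mule0.
  by rewrite -!EFinB -EFinM -mulrBl mulrCA divff ?mulr1// gt_eqF.
by rewrite /mscale/= /pushforward muleA -EFinM mulVf ?mul1e// gt_eqF.
Qed.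

Lemma ge0_integral_scale k (f : RT -> \bar R) : 0 < k ->
  measurable_fun setT f -> (forall x, 0 <= f x)%E ->
  (\int[mu]_x f (k * x)%R = k^-1%:E * \int[mu]_x f x)%E.
Proof.
move=> k0 mf f0.
have mk : measurable_fun [set: RT] ( *%R k : RT -> RT).
  exact: mulrl_measurable.
rewrite -[LHS](ge0_integral_pushforward mk mu (D := setT))//.
have kV : 0 <= k^-1 by rewrite invr_ge0 ltW.
rewrite (eq_measure_integral (mscale (NngNum kV) mu)).
  by rewrite ge0_integral_mscale.
by move=> A mA _; exact: lebesgue_measure_scale.
Qed.

Lemma integral_lebesgue_tupleS n (f : n.+1.-tuple RT -> \bar R) :
  measurable_fun setT f -> (forall t, 0 <= f t)%E ->
  (\int[lebesgue_tuple n.+1]_t f t =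
   \int[mu]_x \int[lebesgue_tuple n]_t f (tuple_cons (x, t)))%E.
Proof.
move=> mf f0.
transitivity (\int[(mu \x lebesgue_tuple n)%E]_u f (tuple_cons u))%E.
  by rewrite -[RHS](ge0_integral_pushforward (@measurable_tuple_cons R n)
    (mu \x lebesgue_tuple n)%E (D := setT)).
rewrite (fubini_tonelli1 (fun u => f (tuple_cons u)))//.
by apply: measurableT_comp => //; exact: measurable_tuple_cons.
Qed.

Lemma measurable_sum_tnth (f : R -> R) n : measurable_fun setT f ->
  measurable_fun [set: n.-tuple RT] (fun t => \sum_(i < n) f (tnth t i)).
Proof.
move=> mf; apply: measurable_sum => i.
by apply: measurableT_comp => //; exact: measurable_tnth.
Qed.

Lemma sum_tnth_cons (f : R -> R) n (u : RT * n.-tuple RT) :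
  \sum_(i < n.+1) f (tnth (tuple_cons u) i) =
  f u.1 + \sum_(i < n) f (tnth u.2 i).
Proof.
case: u => x t; rewrite big_ord_recl/=; congr (f _ + _).
by apply: eq_bigr => i _; rewrite tnthS.
Qed.

(** The exponential turns the sum into a product, so by Tonelli one coordinate splits off at a time.
    All integrands are nonnegative, hence the identity also covers the value [+oo]. *)
Lemma integral_expR_sum n (f : R -> R) : measurable_fun setT f ->
  (\int[lebesgue_tuple n]_t (expR (\sum_(i < n) f (tnth t i)))%:E =
   (\int[mu]_x (expR (f x))%:E) ^+ n)%E.
Proof.
move=> mf; elim: n => [|n IH].
  rewrite expe0 /= integral_dirac//; last first.
    apply/measurable_EFinP/measurableT_comp => //.
    exact: measurable_sum_tnth.
  by rewrite diracT mul1e big_ord0 expR0.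
rewrite integral_lebesgue_tupleS; first last.
- by move=> t; rewrite lee_fin expR_ge0.
- by apply/measurable_EFinP/measurableT_comp => //; exact: measurable_sum_tnth.
under eq_integral => x _.
  under eq_integral do rewrite sum_tnth_cons expRD EFinM /=.
  rewrite ge0_integralZl//; last first.
    apply/measurable_EFinP/measurableT_comp => //.
    exact: measurable_sum_tnth.
  rewrite IH.
  over.
rewrite ge0_integralZr//; last 2 first.
- by apply/measurable_EFinP/measurableT_comp.
- by rewrite -IH integral_ge0.
by rewrite expeS.
Qed.

Definition lp_sum p n (t : n.-tuple RT) : R := \sum_(i < n) `|tnth t i : R| `^ p.

(** The argument [r] may be negative: the set is then empty, so the slicing formula [lp_volS]
    integrates over the whole line without a case distinction. *)
Definition lp_vol p n r : \bar R := lebesgue_tuple n [set t | lp_sum p t <= r].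

Lemma measurable_powR_norm p : measurable_fun setT (fun x : R => `|x| `^ p).
Proof.
by apply: (@measurableT_comp _ _ _ _ _ _ (fun y : R => y `^ p)).
Qed.

Lemma measurable_lp_sum p n : measurable_fun setT (@lp_sum p n).
Proof. exact: (measurable_sum_tnth (measurable_powR_norm p)). Qed.

Lemma measurable_lp_sum_le p n r :
  measurable [set t : n.-tuple RT | lp_sum p t <= r].
Proof.
rewrite -[X in measurable X]setTI.
exact: (measurable_fun_ler (@measurable_lp_sum p n) (measurable_cst r)).
Qed.

Lemma lp_sum_cons p n (u : RT * n.-tuple RT) :
  lp_sum p (tuple_cons u) = `|u.1 : R| `^ p + lp_sum p u.2.
Proof. exact: (sum_tnth_cons (fun x => `|x| `^ p)). Qed.

Lemma lp_volS p n r :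
  (lp_vol p n.+1 r = \int[mu]_x lp_vol p n (r - `|x| `^ p)%R)%E.
Proof.
rewrite /lp_vol /= /lebesgue_tupleS /pushforward /product_measure1.
apply: eq_integral => x _ /=; congr (lebesgue_tuple n _).
apply/seteqP; split=> t; rewrite /xsection/= inE/= lp_sum_cons/= => ?; lra.
Qed.

(** The volume at [r] is the measure of the section at [r] of one measurable set in the product
    space, and section measures are measurable. *)
Lemma measurable_lp_vol p n : measurable_fun setT (lp_vol p n).
Proof.
pose A := [set u : RT * n.-tuple RT | lp_sum p u.2 <= u.1].
have mA : measurable A.
  rewrite -[X in measurable X]setTI; apply: measurable_fun_ler => //.
  by apply: measurableT_comp => //; exact: measurable_lp_sum.
have := @measurable_fun_xsection _ _ _ _ _ (lebesgue_tuple n) _ mA.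
congr (measurable_fun _ _); apply/funext => r /=.
by congr (lebesgue_tuple n _); apply/seteqP; split=> t; rewrite /xsection/= inE.
Qed.

(** Induction on [n]: rescaling the first coordinate in [lp_volS] contributes one factor [k], the
    induction hypothesis on each slice the remaining ones. *)
Lemma lp_vol_scale p n k r : 0 < k ->
  (lp_vol p n (k `^ p * r) = (k ^+ n)%:E * lp_vol p n r)%E.
Proof.
move=> k0; elim: n r => [|n IH] r.
  rewrite expr0 mul1e /lp_vol; congr (lebesgue_tuple 0 _).
  apply/seteqP; split=> t; rewrite /lp_sum/= !big_ord0 pmulr_rge0//;
    exact: powR_gt0.
rewrite !lp_volS.
pose g x := (lp_vol p n (k `^ p * r - `|x| `^ p))%E.
have mg : measurable_fun [set: RT] g.
  apply: (measurableT_comp (measurable_lp_vol p n)).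
  by apply: measurable_funB => //; exact: measurable_powR_norm.
have g0 x : (0 <= g x)%E by exact: measure_ge0.
have := ge0_integral_scale k0 mg g0.
have -> : (fun x => g (k * x)) =
    (fun x => (k ^+ n)%:E * lp_vol p n (r - `|x| `^ p)%R)%E.
  apply/funext => x; rewrite /g normrM (gtr0_norm k0) powRM ?(ltW k0)//.
  by rewrite -mulrBr IH.
rewrite ge0_integralZl//; last 2 first.
- apply: (measurableT_comp (measurable_lp_vol p n)).
  by apply: measurable_funB => //; exact: measurable_powR_norm.
- by rewrite lee_fin exprn_ge0// ltW.
move=> /(congr1 (fun z => k%:E * z)%E).
by rewrite !muleA -!EFinM -exprS divff ?gt_eqF// mul1e => ->.
Qed.

End tuple_volume.

(** * Two-sided volume bounds for [l_p] balls, up to a polynomial factor *)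

Section lp_volume_bounds.
Context {R : realType}.
Local Notation RT := (measurableTypeR R).
Local Notation mu := (@lebesgue_measure R).
Implicit Types (p r x : R) (n k : nat).

(** Exponential Markov inequality: the indicator of [A] is at most [exp (sum f - b)], whose integral
    factorizes over the coordinates. *)
Lemma lebesgue_tuple_chernoff n (f : R -> R) (b : R) (A : set (n.-tuple RT)) :
  measurable_fun setT f -> measurable A ->
  (forall t, A t -> b <= \sum_(i < n) f (tnth t i)) ->
  (lebesgue_tuple n A <=
   (expR (- b))%:E * (\int[mu]_x (expR (f x))%:E) ^+ n)%E.
Proof.
move=> mf mA bf.
have mS : measurable_fun [set: n.-tuple RT]
    (fun t => (expR (\sum_(i < n) f (tnth t i)))%:E).
  apply/measurable_EFinP/measurableT_comp => //.
  exact: measurable_sum_tnth.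
rewrite -integral_expR_sum// -ge0_integralZl//.
rewrite -[X in lebesgue_tuple n X]setIT -integral_indic//.
apply: ge0_le_integral => //.
- by apply/measurable_EFinP; exact: measurable_indic.
- exact: measurable_funeM.
move=> t _; rewrite -EFinM lee_fin -expRD indicE.
have [tA|_] := boolP (t \in A); last exact: expR_ge0.
by rewrite -expR0 ler_expR addrC subr_ge0 bf// -in_setE.
Qed.

(** At [a = 1/p] this is the constant [c], the mass of the unnormalized p-Gaussian density. *)
Definition lp_weight p (a : R) : \bar R :=
  (\int[mu]_x (expR (- (a * `|x| `^ p)))%:E)%E.

Lemma nneseries_geometric_le (q : R) : 0 < q < 1 ->
  (\sum_(k <oo) (q ^+ k)%:E <= ((1 - q)^-1)%:E)%E.
Proof.
move=> /andP[q0 q1].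
have q0' k : true -> (0 <= (q ^+ k)%:E)%E.
  by move=> _; rewrite lee_fin exprn_ge0// ltW.
apply: lime_le; first by apply: is_cvg_nneseries => k _; exact: q0'.
apply: nearW => m; rewrite sumEFin lee_fin.
have := @geometric_le_lim R m 1 q ler01 q0.
rewrite ger0_norm ?(ltW q0)// => /(_ q1); rewrite mul1r; apply: le_trans.
by rewrite /series/= /geometric/=; under [leRHS]eq_bigr do rewrite mul1r.
Qed.

(** The left side bounds the shell between [k] and [k+1] relative to the volume of [{N <= n}]: its
    largest weight times the scaling factor of [{N <= k+1}]. *)
Lemma powR_ratio_le p n (k : nat) : 0 < p -> (0 < n)%N ->
  expR (- (k%:R / p)) * (k.+1%:R / n%:R) `^ (n%:R / p) <=
  expR ((2 - n%:R) / p) * expR (- (p * n.+1%:R)^-1) ^+ k.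
Proof.
move=> p0 n0.
have n0' : 0 < n%:R :> R by rewrite ltr0n.
have k0 : 0 < k.+1%:R / n%:R :> R by rewrite divr_gt0// ltr0n.
rewrite /powR gt_eqF// -!expRD -expRM_natl -!expRD ler_expR.
(* Splitting off [n.+1%:R] instead of [n%:R] before using [ln y <= y - 1] leaves
   a geometric factor in [k], which makes the bound summable. *)
have : ln (k.+1%:R / n%:R : R) <= k.+1%:R / n.+1%:R - 1 + n%:R^-1.
  have -> : k.+1%:R / n%:R = (k.+1%:R / n.+1%:R) * (n.+1%:R / n%:R) :> R.
    by rewrite mulrA divfK// pnatr_eq0.
  rewrite lnM ?posrE ?divr_gt0 ?ltr0n//.
  apply: lerD.
    rewrite -[X in ln X](subrK 1) addrC le_ln1Dx// -subr_gt0 opprK subrK.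
    by rewrite divr_gt0// ltr0n.
  rewrite -natr1 mulrDl divff ?gt_eqF// mul1r le_ln1Dx//.
  by rewrite (@lt_trans _ _ 0)// ?ltrN10 ?invr_gt0.
move=> h.
apply: (@le_trans _ _ (- (k%:R / p) + n%:R / p * (k.+1%:R / n.+1%:R - 1 + n%:R^-1))).
  by rewrite lerD2l ler_pM2l// divr_gt0.
rewrite -(ler_pM2r p0) -[k.+1%:R]natr1 -[n.+1%:R]natr1.
have n1 : 0 < n%:R + 1 :> R by rewrite addr_gt0.
have -> : (- (k%:R / p) + n%:R / p * ((k%:R + 1) / (n%:R + 1) - 1 + n%:R^-1)) * p
  = (2 - n%:R) - k%:R / (n%:R + 1) - (n%:R + 1)^-1.
  by field; rewrite !gt_eqF.
have -> : ((2 - n%:R) / p + k%:R * - (p * (n%:R + 1))^-1) * p =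
   (2 - n%:R) - k%:R / (n%:R + 1) by field; rewrite !gt_eqF.
by rewrite gerBl invr_ge0 ltW.
Qed.

Lemma lp_vol_ge p n : 0 < p -> (0 < n)%N ->
  (lp_weight p p^-1 ^+ n <=
   (expR ((2 - n%:R) / p) * (1 + p * n.+1%:R))%:E * lp_vol p n n%:R)%E.
Proof.
move=> p0 n0.
have n0' : 0 < n%:R :> R by rewrite ltr0n.
have mf : measurable_fun setT (fun x : R => - (p^-1 * `|x| `^ p)).
  by apply: measurable_funN; apply: measurable_funM => //;
    exact: measurable_powR_norm.
rewrite /lp_weight -integral_expR_sum//.
pose B (k : nat) : set (n.-tuple RT) := [set t | lp_sum p t <= k.+1%:R].
have mB k : measurable (B k) by exact: measurable_lp_sum_le.
pose F (k : nat) (t : n.-tuple RT) : \bar R :=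
  ((expR (- (k%:R / p)))%:E * (\1_(B k) t)%:E)%E.
have F0 k t : (0 <= F k t)%E by rewrite mule_ge0// lee_fin ?expR_ge0.
have mF k : measurable_fun setT (F k).
  by apply: measurable_funeM; apply/measurable_EFinP; exact: measurable_indic.
(* [exp(-u/p) <= \sum_k exp(-k/p) 1_{u <= k+1}] for [u >= 0]. *)
apply: (@le_trans _ _ (\int[lebesgue_tuple n]_t (\sum_(k <oo) F k t))%E).
  apply: ge0_le_integral => //.
  - apply/measurable_EFinP; apply: measurableT_comp => //.
    exact: (measurable_sum_tnth mf).
  - exact: ge0_emeasurable_sum.
  move=> t _.
  have -> : \sum_(i < n) - (p^-1 * `|tnth t i| `^ p) = - (lp_sum p t / p).
    by rewrite sumrN -mulr_sumr mulrC.
  have N0 : 0 <= lp_sum p t by apply: sumr_ge0 => i _; exact: powR_ge0.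
  have /andP[kN Nk] := truncn_itv N0.
  set k := Num.truncn _ in kN Nk.
  apply: (@le_trans _ _ (F k t)); last first.
    apply: le_trans (nneseries_lim_ge k.+1 _); last by move=> *; exact: F0.
    rewrite big_nat_recr//= leeDr// sume_ge0//.
  rewrite /F indicE mem_set; last exact: ltW.
  by rewrite mule1 lee_fin ler_expR lerN2 ler_pM2r ?invr_gt0.
rewrite integral_nneseries//.
apply: (@le_trans _ _ (\sum_(k <oo)
  ((expR ((2 - n%:R) / p))%:E * lp_vol p n n%:R *
   (expR (- (p * n.+1%:R)^-1) ^+ k)%:E))%E).
  apply: lee_nneseries => k _; first by rewrite integral_ge0.
  rewrite ge0_integralZl//; last first.
    by apply/measurable_EFinP; exact: measurable_indic.
  have -> : (\int[lebesgue_tuple n]_t (\1_(B k) t)%:E = lp_vol p n k.+1%:R)%E.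
    by rewrite integral_indic// setIT.
  have k0 : 0 < k.+1%:R / n%:R :> R by rewrite divr_gt0// ltr0n.
  (* The ball [{N <= k+1}] is the dilate of [{N <= n}] by [((k+1)/n)^(1/p)], so all terms become
     multiples of one volume. *)
  have -> : k.+1%:R = ((k.+1%:R / n%:R) `^ p^-1) `^ p * n%:R :> R.
    by rewrite -powRrM mulVf ?gt_eqF// powRr1 ?ltW// divfK// gt_eqF.
  rewrite lp_vol_scale ?powR_gt0// muleA [leRHS]muleAC -!EFinM.
  rewrite lee_wpmul2r ?measure_ge0// lee_fin.
  rewrite -powR_mulrn ?powR_ge0// -powRrM [p^-1 * _]mulrC.
  exact: powR_ratio_le.
have : (0 <= lp_vol p n n%:R)%E by exact: measure_ge0.
case: (lp_vol p n n%:R) => [v v0|_|//]; last first.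
  by rewrite [leRHS]gt0_muley ?leey// lte_fin mulr_gt0 ?expR_gt0// addr_gt0 ?mulr_gt0.
rewrite -EFinM nneseriesZl; last first.
  by move=> k _; rewrite lee_fin exprn_ge0// expR_ge0.
rewrite -EFinM mulrAC [leRHS]EFinM lee_wpmul2l ?lee_fin ?mulr_ge0 ?expR_ge0//.
have y0 : 0 < (p * n.+1%:R)^-1 by rewrite invr_gt0 mulr_gt0// ltr0n.
apply: (le_trans (nneseries_geometric_le _)).
  by rewrite expR_gt0 expR_lt1 oppr_lt0.
(* With [y = 1/(p(n+1))] the claim is [1/(1 - exp(-y)) <= 1 + 1/y], a rearrangement of
   [1 + y <= exp y]. *)
set y := _^-1 in y0 *.
have -> : p * n.+1%:R = y^-1 by rewrite /y invrK.
rewrite lee_fin expRN.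
have h := expR_ge1Dx y; have ey := expR_gt0 y.
have e1 : 0 < expR y - 1 by lra.
have -> : (1 - (expR y)^-1)^-1 = expR y / (expR y - 1).
  by field; rewrite !gt_eqF//; lra.
rewrite ler_pdivrMr// -subr_ge0.
have -> : (1 + y^-1) * (expR y - 1) - expR y = (expR y - (1 + y)) / y.
  by field; rewrite gt_eqF.
by rewrite divr_ge0 ?subr_ge0// ltW.
Qed.

Lemma lp_vol_le p n r : 0 < p ->
  (lp_vol p n r <= (expR (r / p))%:E * lp_weight p p^-1 ^+ n)%E.
Proof.
move=> p0; rewrite -[r / p]opprK; apply: lebesgue_tuple_chernoff.
- by apply: measurable_funN; apply: measurable_funM => //;
    exact: measurable_powR_norm.
- exact: measurable_lp_sum_le.
move=> t tr; rewrite sumrN lerN2 -mulr_sumr mulrC ler_pM2r ?invr_gt0//.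
Qed.

End lp_volume_bounds.

(** * One-dimensional integrals: finiteness and the truncated exponential moment *)

Section lp_weight_integrals.
Context {R : realType}.
Local Notation RT := (measurableTypeR R).
Local Notation mu := (@lebesgue_measure R).
Implicit Types (p r x a T e : R).

Lemma ge0_integral_reflect (f : RT -> \bar R) :
  measurable_fun setT f -> (forall x, 0 <= f x)%E ->
  (\int[mu]_x f (- x)%R = \int[mu]_x f x)%E.
Proof.
move=> mf f0.
have mN : measurable_fun [set: RT] (-%R : RT -> RT) by exact: oppr_measurable.
rewrite -[LHS](ge0_integral_pushforward mN mu (D := setT))//.
apply: eq_measure_integral => A mA _; exact: lebesgue_measureN.
Qed.

(** The integrand is dominated by [1/a] times the sum of the exponential density and its
    reflection. *)
Lemma integral_expR_norm_lty a : 0 < a ->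
  (\int[mu]_x (expR (- (a * `|x|)))%:E < +oo)%E.
Proof.
move=> a0.
pose g x : \bar R := (exponential_pdf a x)%:E.
have mg : measurable_fun setT g.
  by apply/measurable_EFinP; exact: measurable_exponential_pdf.
have g0 x : (0 <= g x)%E by rewrite lee_fin exponential_pdf_ge0// ltW.
have mgN : measurable_fun [set: RT] (fun x : RT => g (- x)).
  by apply: (measurableT_comp mg); exact: oppr_measurable.
apply: (@le_lt_trans _ _ (\int[mu]_x (a^-1%:E * (g x + g (- x)%R)))%E).
  apply: ge0_le_integral => //.
  - apply/measurable_EFinP; apply: measurableT_comp => //.
    by apply: measurable_funN; apply: measurable_funM.
  - by apply: measurable_funeM; exact: emeasurable_funD.
  move=> x _; rewrite -EFinD -EFinM lee_fin [leRHS]mulrC ler_pdivlMr// [leLHS]mulrC.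
  have [x0|x0] := leP 0 x.
    rewrite (exponential_pdfE _ x0) ger0_norm// mulNr lerDl.
    by rewrite exponential_pdf_ge0// ltW.
  have Nx0 : 0 <= - x by rewrite oppr_ge0 ltW.
  rewrite (exponential_pdfE _ Nx0) ltr0_norm// mulNr lerDr.
  by rewrite exponential_pdf_ge0// ltW.
rewrite ge0_integralZl//; last 3 first.
- exact: emeasurable_funD.
- by move=> x _; rewrite adde_ge0.
- by rewrite lee_fin invr_ge0 ltW.
rewrite ge0_integralD// ge0_integral_reflect// integral_exponential_pdf//.
by rewrite -EFinD -EFinM ltry.
Qed.

(** Reduces integrability to the exponent 1, through [|x| - 1 <= |x|^p]. *)
Lemma expR_powR_le p a x : 1 <= p -> 0 <= a ->
  expR (- (a * `|x| `^ p)) <= expR a * expR (- (a * `|x|)).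
Proof.
move=> p1 a0; rewrite -expRD ler_expR.
have : `|x| - 1 <= `|x| `^ p.
  have [x1|x1] := leP 1 `|x|.
    by rewrite (le_trans _ (le1r_powR x1 p1))// lerBlDr lerDl.
  by rewrite (@le_trans _ _ 0) ?powR_ge0// subr_le0 ltW.
by move/(ler_wpM2l a0); rewrite mulrBr mulr1; lra.
Qed.


Lemma measurable_expR_powR p a :
  measurable_fun setT (fun x : R => (expR (- (a * `|x| `^ p)))%:E).
Proof.
apply/measurable_EFinP; apply: measurableT_comp => //.
apply: measurable_funN; apply: measurable_funM => //.
exact: measurable_powR_norm.
Qed.

(** On [[0, 1]] the integrand is at least [exp(-a)]. *)
Lemma lp_weight_gt0 p a : 0 < p -> 0 <= a -> (0 < lp_weight p a)%E.
Proof.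
move=> p0 a0.
apply: (@lt_le_trans _ _
    (\int[mu]_x ((expR (- a))%:E * (\1_(`[0, 1]%classic : set RT) x)%:E))%E).
  rewrite ge0_integralZl//.
    rewrite integral_indic// setIT/= lebesgue_measure_itv/= lte_fin ltr01.
    by rewrite -EFinB -EFinM lte_fin subr0 mulr1 expR_gt0.
  by apply/measurable_EFinP; exact: measurable_indic.
apply: ge0_le_integral => //.
- by apply: measurable_funeM; apply/measurable_EFinP; exact: measurable_indic.
- exact: measurable_expR_powR.
move=> x _; rewrite -EFinM lee_fin indicE.
have [|_] := boolP (x \in _); last by rewrite mulr0 expR_ge0.
rewrite inE/= in_itv/= => /andP[x0 x1].
rewrite mulr1 ler_expR lerN2 ger0_norm// ler_piMr//.
apply: (@le_trans _ _ (1 `^ p)); last by rewrite powR1.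
by rewrite ge0_ler_powR ?nnegrE// ltW.
Qed.

Lemma lp_weight_lty p a : 1 <= p -> 0 < a -> (lp_weight p a < +oo)%E.
Proof.
move=> p1 a0.
apply: (@le_lt_trans _ _
    (\int[mu]_x ((expR a)%:E * (expR (- (a * `|x|)))%:E))%E).
  apply: ge0_le_integral => //.
  - exact: measurable_expR_powR.
  - apply: measurable_funeM; apply/measurable_EFinP; apply: measurableT_comp => //.
    by apply: measurable_funN; apply: measurable_funM.
  by move=> x _; rewrite -EFinM lee_fin expR_powR_le// ltW.
rewrite ge0_integralZl//; last first.
  apply/measurable_EFinP; apply: measurableT_comp => //.
  by apply: measurable_funN; apply: measurable_funM.
by rewrite lte_mul_pinfty ?integral_expR_norm_lty// lee_fin expR_ge0.
Qed.

(** Unnormalized second moment; at [a = e/p] it is the constant of the [O(l)] term in the truncated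
    exponential moment. *)
Definition lp_moment2 p a : \bar R :=
  (\int[mu]_x (x ^+ 2 * expR (- (a * `|x| `^ p)))%:E)%E.

Lemma measurable_lp_moment2 p a :
  measurable_fun setT (fun x : R => (x ^+ 2 * expR (- (a * `|x| `^ p)))%:E).
Proof.
apply/measurable_EFinP; apply: measurable_funM => //.
by apply/measurable_EFinP; exact: measurable_expR_powR.
Qed.

(** Half of the exponential decay absorbs the square, by [x^2 <= 2/b^2 * exp(b|x|)] with [b = a/2];
    the factor [exp a] in [K] is the cost of [expR_powR_le]. *)
Lemma lp_moment2_lty p a : 1 <= p -> 0 < a -> (lp_moment2 p a < +oo)%E.
Proof.
move=> p1 a0; pose b := a / 2.
have b0 : 0 < b by rewrite divr_gt0.
pose K := 2 / b ^+ 2 * expR a.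
have K0 : 0 <= K by rewrite mulr_ge0 ?expR_ge0// divr_ge0// exprn_ge0// ltW.
have mb : measurable_fun setT (fun x : R => (expR (- (b * `|x|)))%:E).
  apply/measurable_EFinP; apply: measurableT_comp => //.
  by apply: measurable_funN; apply: measurable_funM.
apply: (@le_lt_trans _ _ (\int[mu]_x (K%:E * (expR (- (b * `|x|)))%:E))%E).
  apply: ge0_le_integral => //.
  - by move=> x _; rewrite lee_fin mulr_ge0 ?expR_ge0// sqr_ge0.
  - exact: measurable_lp_moment2.
  - exact: measurable_funeM.
  move=> x _; rewrite -EFinM lee_fin.
  have := expR_powR_le x p1 (ltW a0).
  have -> : a * `|x| = b * `|x| + b * `|x| by rewrite /b; field.
  rewrite opprD expRD => h.
  apply: (le_trans (ler_wpM2l (sqr_ge0 x) h)).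
  have bx : 0 <= b * `|x| by rewrite mulr_ge0// ltW.
  have := expR_ge1Dxn 1 bx.
  rewrite /K expRN; set u := expR (b * _) => hu.
  have u0 : 0 < u by exact: expR_gt0.
  have -> : x ^+ 2 * (expR a * (u^-1 / u)) =
    (x ^+ 2 / u) * (expR a / u) by field; rewrite gt_eqF.
  rewrite -[leRHS]mulrA ler_wpM2r ?divr_ge0 ?expR_ge0 ?(ltW u0)//.
  rewrite ler_pdivrMr// mulrAC ler_pdivlMr ?exprn_gt0//.
  move: hu; rewrite exprMn real_normK ?num_real//.
  rewrite (_ : (2`!)%:R = 2 :> R)//; nra.
rewrite ge0_integralZl//.
by rewrite lte_mul_pinfty ?integral_expR_norm_lty// lee_fin.
Qed.

(** Since [p <= 2], the power [p - 2] is nonincreasing, which settles [|x| <= T]. Beyond [T] the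
    left side stays at [T^p]. *)
Lemma powR_min_sqr_le p T x : 0 < p <= 2 -> 0 < T ->
  T `^ (p - 2) * Num.min (x ^+ 2) (T ^+ 2) <= `|x| `^ p.
Proof.
move=> /andP[p0 p2] T0.
have TE : T `^ (p - 2) * T ^+ 2 = T `^ p.
  rewrite -powR_mulrn ?(ltW T0)// -powRD ?subrK//.
  by rewrite (gt_eqF T0) implybT.
have [xT|Tx] := leP `|x| T; last first.
  apply: (@le_trans _ _ (T `^ (p - 2) * T ^+ 2)).
    by rewrite ler_wpM2l ?powR_ge0// ge_min lexx orbT.
  by rewrite TE ge0_ler_powR ?nnegrE// ltW.
apply: (@le_trans _ _ (T `^ (p - 2) * x ^+ 2)).
  by rewrite ler_wpM2l ?powR_ge0// ge_min lexx.
have [->|x0] := eqVneq x 0; first by rewrite expr0n mulr0 powR_ge0.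
have nx0 : 0 < `|x| by rewrite normr_gt0.
rewrite -[x ^+ 2]real_normK ?num_real//.
have -> : `|x| `^ p = `|x| `^ (p - 2) * `|x| ^+ 2.
  rewrite -powR_mulrn// -powRD ?subrK//.
  by rewrite (gt_eqF nx0) implybT.
rewrite ler_wpM2r ?sqr_ge0// -[p - 2]opprB !powRN lef_pV2 ?posrE ?powR_gt0//.
by rewrite ge0_ler_powR ?nnegrE ?subr_ge0// ltW.
Qed.

(** Expand with [exp y <= 1 + y exp y] at [y = l min(x^2, T^2)]. The 1 integrates to the weight; in
    the rest, [powR_min_sqr_le] and the choice of [l] give [y <= (1-e)|x|^p/p], so a density
    [exp(-e|x|^p/p)] remains. *)
Lemma lp_truncated_mgf_le p T e l : 0 < p <= 2 -> 0 < T -> 0 < e < 1 ->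
  l = (1 - e) / p * T `^ (p - 2) ->
  (\int[mu]_x (expR (l * Num.min (x ^+ 2) (T ^+ 2) - p^-1 * `|x| `^ p))%:E <=
   lp_weight p p^-1 + l%:E * lp_moment2 p (e / p))%E.
Proof.
move=> p02 T0 /andP[e0 e1] lE; have /andP[p0 p2] := p02.
have ep0 : 0 <= (1 - e) / p by rewrite divr_ge0 ?subr_ge0// ltW.
have l0 : 0 <= l by rewrite lE mulr_ge0 ?powR_ge0.
rewrite /lp_moment2 -ge0_integralZl//; last 2 first.
- exact: measurable_lp_moment2.
- by move=> x _; rewrite lee_fin mulr_ge0 ?expR_ge0// sqr_ge0.
rewrite /lp_weight -ge0_integralD//; last 3 first.
- exact: measurable_expR_powR.
- move=> x _; rewrite -EFinM lee_fin mulr_ge0// mulr_ge0 ?expR_ge0//.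
  exact: sqr_ge0.
- by apply: measurable_funeM; exact: measurable_lp_moment2.
apply: ge0_le_integral => //.
- apply/measurable_EFinP; apply: measurableT_comp => //.
  apply: measurable_funB; apply: measurable_funM => //.
    exact: measurable_minr.
  exact: measurable_powR_norm.
- apply: emeasurable_funD; first exact: measurable_expR_powR.
  by apply: measurable_funeM; exact: measurable_lp_moment2.
move=> x _; rewrite -EFinM -EFinD lee_fin.
set w := `|x| `^ p; set m := Num.min _ _.
have m0 : 0 <= m by rewrite le_min !sqr_ge0.
have mx : m <= x ^+ 2 by rewrite ge_min lexx.
have lm : l * m <= (1 - e) / p * w.
  by rewrite lE -mulrA ler_wpM2l ?powR_min_sqr_le.
have lm0 : 0 <= l * m by rewrite mulr_ge0.
rewrite expRD.
have h1 : expR (l * m) <= 1 + l * m * expR (l * m).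
  have := expR_ge1Dx (- (l * m)); rewrite expRN.
  move/(ler_wpM2r (expR_ge0 (l * m))); rewrite mulVf ?expR_eq0//; lra.
apply: (le_trans (ler_wpM2r (expR_ge0 _) h1)).
rewrite mulrDl mul1r lerD2l.
have -> : l * m * expR (l * m) * expR (- (p^-1 * w)) =
  l * (m * expR (l * m - p^-1 * w)) by rewrite expRD; ring.
rewrite ler_wpM2l//.
apply: ler_pM => //.
rewrite ler_expR.
have -> : - (e / p * w) = (1 - e) / p * w - p^-1 * w by ring.
by rewrite lerD2r.
Qed.

End lp_weight_integrals.

(** * Tail bounds for the Euclidean norm in fixed dimension *)

Section lp_ball_tails.
Context {R : realType}.
Local Notation RT := (measurableTypeR R).
Local Notation mu := (@lebesgue_measure R).
Implicit Types (p r x a T e : R) (n : nat).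

Lemma lee_expe2r n (x y : \bar R) : (0 <= x -> x <= y -> x ^+ n <= y ^+ n)%E.
Proof.
move=> x0 xy; elim: n => [|n IH]; first by rewrite !expe0.
by rewrite !expeS lee_pmul// expe_ge0.
Qed.

Lemma sqr_norm2 n (t : n.-tuple RT) :
  norm2 t ^+ 2 = \sum_(i < n) (tnth t i : R) ^+ 2.
Proof. by rewrite sqr_sqrtr// sumr_ge0// => i _; exact: sqr_ge0. Qed.

Lemma norm2_ge0 n (t : n.-tuple RT) : 0 <= norm2 t.
Proof. exact: sqrtr_ge0. Qed.

Lemma measurable_norm2 n : measurable_fun setT (@norm2 R n).
Proof.
apply: (@measurableT_comp _ _ _ _ _ _ (@Num.sqrt R)) => //.
  by apply: continuous_measurable_fun; exact: sqrt_continuous.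
apply: measurable_sum => i; apply: measurable_funX.
exact: measurable_tnth.
Qed.

Lemma dilate_lp_ball p n : 0 < p -> (0 < n)%N ->
  dilate (n%:R `^ p^-1) (lp_ball p n) = [set t : n.-tuple RT | lp_sum p t <= n%:R].
Proof.
move=> p0 n0; have n0' : 0 < n%:R :> R by rewrite ltr0n.
set k := n%:R `^ p^-1; have k0 : 0 < k by exact: powR_gt0.
have kp : k `^ p = n%:R by rewrite -powRrM mulVf ?gt_eqF// powRr1// ltW.
have scale (t t' : n.-tuple RT) : (forall i, tnth t' i = k * tnth t i) ->
    lp_sum p t' = n%:R * \sum_(i < n) `|tnth t i : R| `^ p.
  move=> tt'; rewrite -kp mulr_sumr; apply: eq_bigr => i _.
  by rewrite tt' normrM (gtr0_norm k0) powRM// ltW.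
apply/seteqP; split=> [_ [t /= tK <-]|t tn].
  by rewrite (scale t) ?ler_piMr ?(ltW n0')// => i; rewrite tnth_mktuple.
exists [tuple (k^-1 * tnth t i : R) | i < n].
  rewrite /lp_ball/= -(ler_pM2l n0') mulr1 -(scale _ t)//.
  by move=> i; rewrite tnth_mktuple mulrA divff ?mul1r// gt_eqF.
apply: eq_from_tnth => i.
by rewrite !tnth_mktuple mulrA divff ?mul1r// gt_eqF.
Qed.

Lemma lp_weightE p : 1 <= p ->
  exists2 c : R, 0 < c & lp_weight p p^-1 = c%:E.
Proof.
move=> p1; have p0 : 0 < p by exact: lt_le_trans p1.
have w0 : (0 < lp_weight p p^-1)%E by rewrite lp_weight_gt0// invr_ge0 ltW.
have wy : (lp_weight p p^-1 < +oo)%E by rewrite lp_weight_lty// invr_gt0.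
by move: w0 wy; case: (lp_weight p p^-1) => // c; exists c.
Qed.

(** The two volume bounds in real form: the upper one gives finiteness because [c] is finite, the
    lower one gives positivity. *)
Lemma lp_vol_natE p n c : 0 < p -> 0 < c -> lp_weight p p^-1 = c%:E ->
  (0 < n)%N ->
  exists v : R, [/\ lp_vol p n n%:R = v%:E, 0 < v,
    v <= expR (n%:R / p) * c ^+ n &
    c ^+ n <= expR ((2 - n%:R) / p) * (1 + p * n.+1%:R) * v].
Proof.
move=> p0 c0 cE n0.
have := lp_vol_le n n%:R p0; have := lp_vol_ge p0 n0.
have : (0 <= lp_vol p n n%:R)%E by exact: measure_ge0.
rewrite cE -EFin_expe; case: (lp_vol p n n%:R) => // v _.
rewrite -!EFinM !lee_fin => vge vle; exists v; split => //.
have : 0 < expR ((2 - n%:R) / p) * (1 + p * n.+1%:R) * v.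
  by rewrite (lt_le_trans _ vge)// exprn_gt0.
by rewrite pmulr_rgt0// mulr_gt0 ?expR_gt0// addr_gt0// mulr_gt0.
Qed.

Lemma lp_ball_upper_tail p e : 1 <= p <= 2 -> 0 < e < 1 ->
  exists2 D : R, 0 <= D & forall n T, (0 < n)%N -> 0 < T ->
  (lebesgue_tuple n ([set t | T <= norm2 t] `&` [set t | lp_sum p t <= n%:R])%R /
   lp_vol p n n%:R <=
   (expR (2 / p) * (1 + p * n.+1%:R) *
    expR (- ((1 - e) / p * T `^ p) + D * (n%:R * T `^ (p - 2))))%:E)%E.
Proof.
move=> /andP[p1 p2] /andP[e0 e1].
have p0 : 0 < p by exact: lt_le_trans p1.
have ep0 : 0 <= (1 - e) / p by rewrite divr_ge0 ?subr_ge0// ltW.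
have [c c0 cE] := lp_weightE p1.
have [C C0 CE] : exists2 C, 0 <= C & lp_moment2 p (e / p) = C%:E.
  have : (lp_moment2 p (e / p) < +oo)%E by rewrite lp_moment2_lty// divr_gt0.
  have : (0 <= lp_moment2 p (e / p))%E.
    by apply: integral_ge0 => x _; rewrite lee_fin mulr_ge0 ?expR_ge0// sqr_ge0.
  by case: (lp_moment2 _ _) => // C; exists C.
(* With this constant, [D n T^(p-2)] equals [n l C/c], the exponent lost in
   [(c + l C)^n <= c^n exp(n l C/c)]. *)
exists ((1 - e) / p * (C / c)); first by rewrite mulr_ge0// divr_ge0// ltW.
move=> n T n0 T0; pose l := (1 - e) / p * T `^ (p - 2).
have l0 : 0 <= l by rewrite mulr_ge0 ?powR_ge0.
have [v [-> v0 vle vge]] := lp_vol_natE p0 c0 cE n0.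
rewrite inver gt_eqF// lee_pdivrMr//.
pose f x := l * Num.min (x ^+ 2) (T ^+ 2) - p^-1 * `|x| `^ p.
have mf : measurable_fun setT f.
  apply: measurable_funB; apply: measurable_funM => //.
    exact: measurable_minr.
  exact: measurable_powR_norm.
apply: le_trans (lebesgue_tuple_chernoff (b := l * T ^+ 2 - n%:R / p) mf _ _) _.
- apply: measurableI; last exact: measurable_lp_sum_le.
  rewrite -[X in measurable X]setTI.
  by apply: measurable_fun_ler => //; exact: measurable_norm2.
- move=> t [/= Tt tn]; rewrite sumrB -mulr_sumr -mulr_sumr.
  apply: lerB; last by rewrite mulrC ler_pM2r ?invr_gt0.
  apply: ler_wpM2l => //.
  have T2 : T ^+ 2 <= \sum_(i < n) tnth t i ^+ 2.
    by rewrite -sqr_norm2 ler_sqr ?nnegrE ?norm2_ge0// ltW.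
  (* Either one coordinate reaches [T] and its truncated square alone suffices, or no truncation
     takes place. *)
  have [/existsP[i iT]|/existsPn h] := boolP [exists i, T ^+ 2 <= tnth t i ^+ 2].
    rewrite (bigD1 i)//= min_r// lerDl sumr_ge0// => j _.
    by rewrite le_min !sqr_ge0.
  rewrite (le_trans T2)// ler_sum// => i _.
  by rewrite min_l// ltW// ltNge h.
have TE : l * T ^+ 2 = (1 - e) / p * T `^ p.
  rewrite /l -mulrA -powR_mulrn ?(ltW T0)// -powRD ?subrK//.
  by rewrite (gt_eqF T0) implybT.
apply: (@le_trans _ _ ((expR (- (l * T ^+ 2 - n%:R / p)))%:E *
    (c + l * C)%:E ^+ n)%E).
  rewrite lee_wpmul2l// ?lee_fin ?expR_ge0//.
  have -> : (c + l * C)%:E = (lp_weight p p^-1 + l%:E * lp_moment2 p (e / p))%E.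
    by rewrite cE CE.
  apply: lee_expe2r; last first.
    by apply: lp_truncated_mgf_le; rewrite ?p0 ?p2 ?e0 ?e1.
  by apply: integral_ge0 => x _; rewrite lee_fin expR_ge0.
rewrite -EFin_expe -EFinM -EFinM lee_fin.
have cl : (c + l * C) ^+ n <= c ^+ n * expR (n%:R * (l * (C / c))).
  have -> : c + l * C = c * (1 + l * (C / c)) by field; rewrite gt_eqF.
  rewrite exprMn expRM_natl ler_wpM2l ?exprn_ge0 ?(ltW c0)//.
  rewrite lerXn2r ?nnegrE ?expR_ge0 ?expR_ge1Dx//.
  by rewrite addr_ge0// mulr_ge0// divr_ge0// ltW.
apply: (le_trans (ler_wpM2l (expR_ge0 _) cl)).
(* The lower volume bound trades [c^n] for [v]; its [exp(-n/p)] cancels the [exp(n/p)] of the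
   Chernoff bound. *)
have := ler_wpM2r (mulr_ge0 (expR_ge0 (- (l * T ^+ 2 - n%:R / p)))
  (expR_ge0 (n%:R * (l * (C / c))))) vge.
rewrite mulrCA => /le_trans; apply.
have -> : - ((1 - e) / p * T `^ p) + (1 - e) / p * (C / c) * (n%:R * T `^ (p - 2)) =
  - (l * T ^+ 2 - n%:R / p) + n%:R * (l * (C / c)) - n%:R / p.
  by rewrite TE /l; ring.
rewrite mulrDl !expRD !mulNr.
rewrite le_eqVlt; apply/orP; left; apply/eqP; ring.
Qed.

(** A slab of width 1 in the first coordinate uses at most [(T+1)^p] of the budget [n+1] and leaves
    [r] to the other [n] coordinates. Scaling from [n] to [r] gives the power of [r/n]. *)
Lemma lp_ball_lower_tail p : 1 <= p ->
  exists2 D : R, 0 < D & forall n T r, (0 < n)%N -> 0 <= T -> 0 < r ->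
  r + (T + 1) `^ p <= n.+1%:R ->
  ((D / (1 + p * n.+1%:R) * (r / n%:R) `^ (n%:R / p))%:E <=
   lebesgue_tuple n.+1
     ([set t | T < norm2 t] `&` [set t | lp_sum p t <= n.+1%:R])%R /
   lp_vol p n.+1 n.+1%:R)%E.
Proof.
move=> p1; have p0 : 0 < p by exact: lt_le_trans p1.
have [c c0 cE] := lp_weightE p1.
(* Comparing dimensions [n] and [n+1] leaves one factor [c] and [exp] of
   [(n+1)/p + (2-n)/p = 3/p]. *)
exists (expR (- (3 / p)) / c); first by rewrite divr_gt0// expR_gt0.
move=> n T r n0 T0 r0 rT.
have n0' : 0 < n%:R :> R by rewrite ltr0n.
have [v [-> v0 vle _]] := lp_vol_natE p0 c0 cE (ltn0Sn n).
have [w [wE w0 _ wge]] := lp_vol_natE p0 c0 cE n0.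
rewrite inver gt_eqF// lee_pdivlMr//.
have Er : lp_vol p n r = ((r / n%:R) `^ (n%:R / p) * w)%:E.
  have {1}-> : r = ((r / n%:R) `^ p^-1) `^ p * n%:R.
    have rn0 : 0 < r / n%:R by rewrite divr_gt0.
    by rewrite -powRrM mulVf ?gt_eqF// powRr1 ?(ltW rn0)// divfK// gt_eqF.
  rewrite lp_vol_scale ?powR_gt0 ?divr_gt0// wE -EFinM.
  by rewrite -powR_mulrn ?powR_ge0// -powRrM [p^-1 * _]mulrC.
(* The set contains [(T, T+1] x {N <= r}]. *)
apply: (@le_trans _ _ (lp_vol p n r)).
  rewrite Er -EFinM lee_fin.
  rewrite mulrAC [leRHS]mulrC ler_wpM2r ?powR_ge0//.
  rewrite mulrAC ler_pdivrMr; last by rewrite addr_gt0// mulr_gt0.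
  have p1n : 0 < 1 + p * n.+1%:R by rewrite addr_gt0// mulr_gt0.
  apply: (@le_trans _ _ (expR (- (3 / p)) / c * (expR (n.+1%:R / p) * c ^+ n.+1))).
    by rewrite ler_wpM2l// divr_ge0 ?expR_ge0// ltW.
  have -> : expR (- (3 / p)) / c * (expR (n.+1%:R / p) * c ^+ n.+1) =
      expR (- ((2 - n%:R) / p)) * c ^+ n.
    rewrite exprS -[n.+1%:R]natr1.
    have -> : - ((2 - n%:R) / p) = - (3 / p) + (n%:R + 1) / p by ring.
    by rewrite expRD; field; rewrite gt_eqF.
  apply: (le_trans (ler_wpM2l (expR_ge0 _) wge)).
  by rewrite expRN !mulrA mulVf ?expR_eq0// mul1r mulrC.
rewrite -[leLHS]mul1e.
have <- : mu `]T, T + 1] = 1%E.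
  by rewrite lebesgue_measure_itv/= lte_fin ltrDl ltr01 -EFinB addrAC subrr add0r.
rewrite -(product_measure1E mu (lebesgue_tuple n))//; last exact: measurable_lp_sum_le.
rewrite /= /lebesgue_tupleS /pushforward.
apply: le_measure; rewrite ?inE.
- by apply: measurableX => //; exact: measurable_lp_sum_le.
- rewrite -[X in measurable X]setTI; apply: measurable_tuple_cons => //.
  apply: measurableI; last exact: measurable_lp_sum_le.
  rewrite -[X in measurable X]setTI.
  by apply: measurable_fun_ltr => //; exact: measurable_norm2.
move=> [x t] [/=]; rewrite in_itv/= => /andP[Tx xT] tr; split => /=.
  rewrite -(ltr_pXn2r (ltn0Sn 1)) ?nnegrE ?norm2_ge0// sqr_norm2.
  rewrite (sum_tnth_cons (fun y : R => y ^+ 2) (x, t))/=.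
  apply: (@lt_le_trans _ _ (x ^+ 2)).
    by rewrite ltr_pXn2r ?nnegrE// ltW// (le_lt_trans T0).
  by rewrite lerDl sumr_ge0// => i _; exact: sqr_ge0.
rewrite lp_sum_cons/= (le_trans _ rT)// addrC lerD//.
have x0 : 0 <= x by rewrite ltW// (le_lt_trans T0).
by rewrite ger0_norm// ge0_ler_powR ?nnegrE ?(ltW p0)// addr_ge0.
Qed.

End lp_ball_tails.

(** * Asymptotics of the tail bounds at the speed [s_n] *)

Section lp_ball_rates.
Context {R : realType}.
Implicit Types (p r x a T e d : R) (n : nat).

Definition ldp_speed p n : R := n%:R `^ (2 * p / (2 + p)).

(* [ldp_scale p n = n / sqrt (s_n)], see [sqrt_ldp_speed]. *)
Definition ldp_scale p n : R := n%:R `^ (2 / (2 + p)).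

Lemma ldp_scale_gt0 p n : (0 < n)%N -> 0 < ldp_scale p n.
Proof. by move=> n0; rewrite powR_gt0// ltr0n. Qed.

Lemma ldp_speed_gt0 p n : (0 < n)%N -> 0 < ldp_speed p n.
Proof. by move=> n0; rewrite powR_gt0// ltr0n. Qed.

Lemma ldp_scale_powR p n : ldp_scale p n `^ p = ldp_speed p n.
Proof. by rewrite /ldp_scale -powRrM mulrAC. Qed.

Lemma powRD_gt0 x a b : 0 < x -> x `^ (a + b) = x `^ a * x `^ b.
Proof. by move=> x0; rewrite powRD// (gt_eqF x0) implybT. Qed.

Lemma sqrt_ldp_speed p n : 0 < p -> (0 < n)%N ->
  Num.sqrt (ldp_speed p n) / n%:R = (ldp_scale p n)^-1.
Proof.
move=> p0 n0; have n0' : 0 < n%:R :> R by rewrite ltr0n.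
rewrite -powR12_sqrt ?powR_ge0// -powRrM -[n%:R^-1]powR_inv1 ?(ltW n0')//.
rewrite -powRD_gt0// -powRN; congr (_ `^ _).
by field; rewrite gt_eqF// addr_gt0.
Qed.

Lemma near_powR_ge a (M : R) : 0 < a -> \forall n \near \oo, M <= n%:R `^ a.
Proof.
move=> a0; near=> n.
apply: (le_trans (ler_norm M)).
have -> : `|M| = (`|M| `^ a^-1) `^ a.
  by rewrite -powRrM mulVf ?gt_eqF// powRr1.
rewrite ge0_ler_powR ?nnegrE ?powR_ge0 ?(ltW a0)//.
by near: n; exact: nbhs_infty_ger.
Unshelve. all: end_near. Qed.

(** Absorbs polynomial prefactors: [s_n] is the square of [n^k] with [k = p/(2+p)], while the
    logarithm of a linear term is only [O(n^k)]. *)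
Lemma near_linear_le_expR p (K : R) d : 0 < p -> 0 < d ->
  \forall n \near \oo, K * (1 + p * n.+1%:R) <= expR (d * ldp_speed p n).
Proof.
move=> p0 d0; pose k := p / (2 + p).
have k0 : 0 < k by rewrite divr_gt0// addr_gt0.
pose L := `|K| * (1 + p + p).
have L0 : 0 <= L by rewrite mulr_ge0// !addr_ge0// ltW.
near=> n.
have n0 : (0 < n)%N by near: n; exact: nbhs_infty_gt.
have n0' : 0 < n%:R :> R by rewrite ltr0n.
have n1 : 1 <= n%:R :> R by rewrite ler1n.
have sE : ldp_speed p n = n%:R `^ k * n%:R `^ k.
  by rewrite -powRD_gt0//; congr (_ `^ _); rewrite /k; field; rewrite gt_eqF// addr_gt0.
(* Raise [n^k <= exp(n^k)] to the power [1/k]. *)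
have nk : n%:R <= expR (k^-1 * n%:R `^ k) :> R.
  rewrite mulrC expRM.
  have {1}-> : n%:R = (n%:R `^ k) `^ k^-1 :> R.
    by rewrite -powRrM divff ?gt_eqF// powRr1// ltW.
  rewrite ge0_ler_powR ?nnegrE ?powR_ge0 ?expR_ge0 ?invr_ge0 ?(ltW k0)//.
  by apply: le_trans (expR_ge1Dx _); rewrite lerDr.
have KL : K * (1 + p * n.+1%:R) <= L * n%:R.
  apply: (@le_trans _ _ (`|K| * (1 + p * n.+1%:R))).
    by rewrite ler_wpM2r ?ler_norm// addr_ge0// mulr_ge0// ltW.
  rewrite /L -mulrA ler_wpM2l// -[n.+1%:R]natr1; nra.
apply: (le_trans KL).
have LE : L <= expR L by apply: le_trans (expR_ge1Dx _); rewrite lerDr.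
apply: (@le_trans _ _ (expR L * expR (k^-1 * n%:R `^ k))).
  by rewrite ler_pM// ltW.
rewrite -expRD ler_expR.
(* One half of [d s_n] pays for the constant [L], the other half for [n^k / k]. *)
have h1 : L / (d / 2) <= ldp_speed p n.
  by near: n; apply: near_powR_ge; rewrite divr_gt0 ?addr_gt0 ?mulr_gt0.
have h2 : k^-1 / (d / 2) <= n%:R `^ k by near: n; exact: near_powR_ge.
move: h1; rewrite ler_pdivrMr ?divr_gt0// => h1.
move: h2; rewrite ler_pdivrMr ?divr_gt0// => h2.
have -> : d * ldp_speed p n = ldp_speed p n * (d / 2) + ldp_speed p n * (d / 2).
  by field.
apply: lerD => //; rewrite [in leRHS]sE mulrAC ler_wpM2r ?powR_ge0//.
Unshelve. all: end_near. Qed.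

(** Put [T = x * ldp_scale p n] in [lp_ball_upper_tail], so that [T^p = x^p s_n]. The prefactor and
    the error term each cost at most a factor [exp(d s_n / 4)]. *)
Lemma lp_ball_upper_rate p x d : 1 <= p < 2 -> 0 < x -> 0 < d ->
  \forall n \near \oo,
  (lebesgue_tuple n ([set t | x * ldp_scale p n <= norm2 t] `&`
     [set t | lp_sum p t <= n%:R])%R / lp_vol p n n%:R <=
   (expR (- (ldp_speed p n * (x `^ p / p - d))))%:E)%E.
Proof.
move=> /andP[p1 p2] x0 d0; have p0 : 0 < p by exact: lt_le_trans p1.
have xp0 : 0 < x `^ p / p by rewrite divr_gt0// powR_gt0.
(* The loss [e x^p/p] in the exponent must stay below [d/2]; the cap at 1/2 keeps [e < 1]. *)
pose e := Num.min 2^-1 (d / 2 / (x `^ p / p)).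
have e0 : 0 < e by rewrite lt_min invr_gt0 ltr0n/= !divr_gt0// powR_gt0.
have e1 : e < 1 by rewrite gt_min invf_lt1 ?ltr1n.
have ed : e * (x `^ p / p) <= d / 2.
  by rewrite -ler_pdivlMr// ge_min lexx orbT.
have p12 : 1 <= p <= 2 by rewrite p1 ltW.
have e01 : 0 < e < 1 by rewrite e0.
have [D D0 tail] := lp_ball_upper_tail p12 e01.
(* The error [n T^(p-2)] is of order [s_n / n^g], and [g > 0] because [p < 2]. *)
pose g := (2 - p) / (2 + p).
have g0 : 0 < g by rewrite divr_gt0 ?subr_gt0 ?addr_gt0.
near=> n.
have n0 : (0 < n)%N by near: n; exact: nbhs_infty_gt.
have n0' : 0 < n%:R :> R by rewrite ltr0n.
have t0 := ldp_scale_gt0 p n0; have s0 := ldp_speed_gt0 p n0.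
apply: (le_trans (tail n _ n0 (mulr_gt0 x0 t0))); rewrite lee_fin.
rewrite !powRM ?(ltW x0) ?(ltW t0)// ldp_scale_powR.
have ng : n%:R * ldp_scale p n `^ (p - 2) * n%:R `^ g = ldp_speed p n.
  rewrite -powRrM -[X in X * _ * _]powRr1 ?(ltW n0')// -!powRD_gt0//.
  by congr (_ `^ _); rewrite /g; field; rewrite gt_eqF// addr_gt0.
have h1 : expR (2 / p) * (1 + p * n.+1%:R) <= expR (d / 4 * ldp_speed p n).
  by near: n; apply: near_linear_le_expR => //; rewrite divr_gt0.
have h2 : D * (n%:R * (x `^ (p - 2) * ldp_scale p n `^ (p - 2))) <=
    d / 4 * ldp_speed p n.
  have : D * x `^ (p - 2) / (d / 4) <= n%:R `^ g.
    by near: n; exact: near_powR_ge.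
  rewrite ler_pdivrMr ?divr_gt0// => h.
  pose u := n%:R * ldp_scale p n `^ (p - 2).
  have u0 : 0 <= u by rewrite mulr_ge0 ?powR_ge0.
  have -> : D * (n%:R * (x `^ (p - 2) * ldp_scale p n `^ (p - 2))) =
    D * x `^ (p - 2) * u by rewrite /u; ring.
  have -> : d / 4 * ldp_speed p n = n%:R `^ g * (d / 4) * u.
    by rewrite -ng -/u; ring.
  exact: ler_wpM2r.
apply: (le_trans (ler_wpM2r (expR_ge0 _) h1)).
rewrite -expRD ler_expR.
have := ler_wpM2r (ltW s0) ed.
move: h2; set z := D * _; set s := ldp_speed p n; move=> h2 h3.
have -> : (1 - e) / p * (x `^ p * s) = x `^ p / p * s - e * (x `^ p / p) * s by ring.
rewrite [s * _]mulrC; lra.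
Unshelve. all: end_near. Qed.

(** In [lp_ball_lower_tail] take dimension [m = n-1] and [r = n - (T+1)^p]. Then [(r/m)^(m/p)] costs
    about [(T+1)^p / p], that is about [x^p s_n / p], in the exponent. *)
Lemma lp_ball_lower_rate p x d : 1 <= p < 2 -> 0 <= x -> 0 < d ->
  \forall n \near \oo,
  ((expR (- (ldp_speed p n * (x `^ p / p + d))))%:E <=
   lebesgue_tuple n ([set t | x * ldp_scale p n < norm2 t] `&`
     [set t | lp_sum p t <= n%:R])%R / lp_vol p n n%:R)%E.
Proof.
move=> /andP[p1 p2] x0 d0; have p0 : 0 < p by exact: lt_le_trans p1.
have [D D0 tail] := lp_ball_lower_tail p1.
(* [b] lies slightly above [x], so that [T + 1 <= b * ldp_scale p n] for large [n]; in the exponent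
   this costs [d/4]. *)
pose B := x `^ p + p * (d / 4); pose b := B `^ p^-1.
have B0 : 0 < B by rewrite ltr_wpDl ?powR_ge0// mulr_gt0// divr_gt0.
have bp : b `^ p = B by rewrite -powRrM mulVf ?gt_eqF// powRr1// ltW.
have xb : x < b.
  rewrite ltNge; apply/negP => bx.
  have : b `^ p <= x `^ p by rewrite ge0_ler_powR ?nnegrE ?powR_ge0 ?(ltW p0).
  by rewrite bp /B gerDl leNgt mulr_gt0// divr_gt0.
(* The factor [1 + e] will bound [m/r]; its cost [e B/p] is another [d/4], and the polynomial
   prefactor takes a third one. *)
pose e := d / 4 / (B / p).
have Bp0 : 0 < B / p by rewrite divr_gt0.
have e0 : 0 < e by rewrite !divr_gt0.
have eB : e * (B / p) = d / 4 by rewrite divfK// gt_eqF.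
pose g := (2 - p) / (2 + p).
have g0 : 0 < g by rewrite divr_gt0 ?subr_gt0 ?addr_gt0.
near=> n.
have n2 : (1 < n)%N by near: n; exact: nbhs_infty_gt.
have n0 : (0 < n)%N by exact: ltn_trans n2.
have n0' : 0 < n%:R :> R by rewrite ltr0n.
have t0 := ldp_scale_gt0 p n0; have s0 := ldp_speed_gt0 p n0.
pose T := x * ldp_scale p n; pose m := n.-1.
have nm : n = m.+1 by rewrite prednK.
have m0 : (0 < m)%N by rewrite -ltnS -nm.
have m0' : 0 < m%:R :> R by rewrite ltr0n.
have nmR : n%:R = m%:R + 1 :> R by rewrite nm -natr1.
have T0 : 0 <= T by rewrite mulr_ge0// ltW.
have ng : ldp_speed p n * n%:R `^ g = n%:R.
  rewrite -powRD_gt0// -[RHS]powRr1 ?(ltW n0')//.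
  by congr (_ `^ _); rewrite /g; field; rewrite gt_eqF// addr_gt0.
have Ts : (T + 1) `^ p <= B * ldp_speed p n.
  rewrite -bp -ldp_scale_powR -powRM ?powR_ge0//.
  rewrite ge0_ler_powR ?nnegrE ?addr_ge0 ?mulr_ge0 ?powR_ge0 ?(ltW p0)//.
  rewrite -lerBrDl -mulrBl mulrC -ler_pdivrMr ?subr_gt0//.
  by near: n; apply: near_powR_ge; rewrite divr_gt0// addr_gt0.
(* As [s_n = o(n)], removing [(T+1)^p] from [n] changes it by a factor close to 1; this yields
   [m <= (1+e) r]. *)
have sn : B * ldp_speed p n * (1 + e) <= e * n%:R.
  have : B * (1 + e) / e <= n%:R `^ g by near: n; exact: near_powR_ge.
  rewrite ler_pdivrMr// => h.
  have -> : e * n%:R = n%:R `^ g * e * ldp_speed p n by rewrite -{1}ng; ring.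
  by rewrite mulrAC ler_wpM2r// ltW.
have Dn : D^-1 * (1 + p * n%:R) <= expR (d / 4 * ldp_speed p n).
  apply: (@le_trans _ _ (D^-1 * (1 + p * n.+1%:R))).
    by rewrite ler_wpM2l ?invr_ge0 ?(ltW D0)// lerD2l ler_wpM2l ?(ltW p0)// ler_nat.
  by near: n; apply: near_linear_le_expR => //; rewrite divr_gt0.
pose s := ldp_speed p n; rewrite -/s in s0 sn Dn Ts *.
pose r := n%:R - (T + 1) `^ p.
have e1 : 0 < 1 + e by rewrite addr_gt0.
have rm : m%:R <= (1 + e) * r.
  have := ler_wpM2l (ltW e1) Ts; rewrite /r; move: sn; set z := _ `^ _; nra.
have r0 : 0 < r by rewrite -(pmulr_rgt0 _ e1) (lt_le_trans m0').
have rT : r + (T + 1) `^ p <= m.+1%:R by rewrite subrK nm.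
have := tail _ _ _ m0 T0 r0 rT; rewrite -nm; apply: le_trans.
rewrite lee_fin.
have pn0 : 0 < 1 + p * n%:R by rewrite addr_gt0// mulr_gt0.
have h1 : expR (- (d / 4 * s)) <= D / (1 + p * n%:R).
  by rewrite expRN -[D / _]invrK lef_pV2 ?posrE ?invr_gt0 ?expR_gt0 ?divr_gt0//
    invf_div mulrC.
(* From [ln(m/r) <= m/r - 1] the exponent is at most [(m/r)(m-r)/p], where [m/r <= 1+e] and
   [m - r <= (T+1)^p <= B s_n]. *)
have h2 : expR (- ((1 + e) * (B / p) * s)) <= (r / m%:R) `^ (m%:R / p).
  rewrite /powR gt_eqF ?divr_gt0// ler_expR.
  have : ln (m%:R / r) <= m%:R / r - 1.
    rewrite -[X in ln X](subrK 1) addrC le_ln1Dx// -subr_gt0 opprK subrK.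
    by rewrite divr_gt0.
  rewrite -[r / m%:R]invf_div lnV ?posrE ?divr_gt0// mulrN lerN2 => h.
  apply: (le_trans (ler_wpM2l _ h)); first by rewrite divr_ge0 ?ltW.
  have -> : m%:R / p * (m%:R / r - 1) = m%:R / r * ((m%:R - r) / p).
    by field; rewrite !gt_eqF.
  have -> : (1 + e) * (B / p) * s = (1 + e) * (B * s / p) by ring.
  have mr : m%:R / r <= 1 + e by rewrite ler_pdivrMr.
  apply: (@le_trans _ _ (m%:R / r * (B * s / p))).
    rewrite ler_wpM2l ?divr_ge0 ?(ltW r0)// ler_pM2r ?invr_gt0//.
    apply: le_trans Ts; rewrite /r nmR; lra.
  by rewrite ler_wpM2r// divr_ge0 ?(ltW p0)// mulr_ge0 ?ltW.
apply: le_trans (ler_pM (expR_ge0 _) (expR_ge0 _) h1 h2).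
rewrite -expRD ler_expR -opprD lerN2.
have -> : d / 4 * s + (1 + e) * (B / p) * s = s * (d / 4 + B / p + e * (B / p)).
  by ring.
rewrite eB ler_pM2l//.
have -> : B / p = x `^ p / p + d / 4 by rewrite /B; field; rewrite gt_eqF.
lra.
Unshelve. all: end_near. Qed.

End lp_ball_rates.

(** * The rate function and the passage from tails to a large deviation principle *)

Section tails_to_ldp.
Context {R : realType}.
Implicit Types (p x a d : R).

Lemma limn_esup_le_near (u : (\bar R)^nat) (l : \bar R) :
  (\forall n \near \oo, (u n <= l)%E) -> (limn_esup u <= l)%E.
Proof.
move=> ul; rewrite /limn_esup limf_esupE.
apply: (@le_trans _ _ (ereal_sup (u @` [set n | (u n <= l)%E]))).
  by apply: ereal_inf_lbound; exists [set n | (u n <= l)%E].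
by apply: ge_ereal_sup => _ [n ? <-].
Qed.

Lemma limn_einf_ge_near (u : (\bar R)^nat) (l : \bar R) :
  (\forall n \near \oo, (l <= u n)%E) -> (l <= limn_einf u)%E.
Proof.
move=> ul; rewrite /limn_einf leeNr; apply: limn_esup_le_near.
by apply: filterS ul => n; rewrite leeN2.
Qed.

Definition powR_rate p x : \bar R := if 0 <= x then (x `^ p / p)%:E else +oo%E.

Lemma powR_rate_le p x a : 0 < p -> 0 <= a ->
  (powR_rate p x <= a%:E)%E = (0 <= x <= (p * a) `^ p^-1).
Proof.
move=> p0 a0; rewrite /powR_rate; case: ifPn => x0 /=; last first.
  by rewrite leNgt ltry.
rewrite lee_fin ler_pdivrMr// [a * p]mulrC.
have pa0 : 0 <= p * a by rewrite mulr_ge0// ltW.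
apply/idP/idP => h.
  have -> : x = (x `^ p) `^ p^-1 by rewrite -powRrM divff ?gt_eqF// powRr1.
  by rewrite ge0_ler_powR ?nnegrE ?powR_ge0 ?invr_ge0 ?(ltW p0).
have -> : p * a = ((p * a) `^ p^-1) `^ p.
  by rewrite -powRrM mulVf ?gt_eqF// powRr1.
by rewrite ge0_ler_powR ?nnegrE ?powR_ge0 ?(ltW p0).
Qed.

Lemma powR_rate_ge0 p x : 0 < p -> (0 <= powR_rate p x)%E.
Proof.
move=> p0; rewrite /powR_rate; case: ifP => _; last exact: leey.
by rewrite lee_fin divr_ge0 ?powR_ge0// ltW.
Qed.

Lemma powR_rate_level p a : 0 < p ->
  [set x | (powR_rate p x <= a%:E)%E] =
  if 0 <= a then `[0, (p * a) `^ p^-1]%classic else set0.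
Proof.
move=> p0; case: ifPn => a0; apply/seteqP; split=> x //=.
- by rewrite powR_rate_le// in_itv.
- by rewrite powR_rate_le// in_itv.
move/(le_trans (powR_rate_ge0 x p0)); rewrite lee_fin.
by move/negP: a0.
Qed.

(** Sublevel sets are segments or empty: compactness is immediate, and lower semicontinuity follows
    as their complements are open. *)
Lemma good_rate_function_powR p : 0 < p -> good_rate_function (powR_rate p).
Proof.
move=> p0; split; last first.
  move=> a; rewrite powR_rate_level//; case: ifP => _.
    exact: segment_compact.
  exact: compact0.
split=> [x|]; first exact: powR_rate_ge0.
apply/lower_semicontinuousP => a.
have -> : [set x | (a%:E < powR_rate p x)%E] =
    ~` [set x | (powR_rate p x <= a%:E)%E].
  by apply/seteqP; split=> x /=; rewrite ltNge => /negP.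
rewrite openC powR_rate_level//; case: ifP => _; last exact: closed0.
exact: interval_closed.
Qed.

(** * A nonnegative sequence with matching exponential tails *)

Section ldp.
Variables (d0 : nat -> measure_display) (T : forall n, measurableType (d0 n)).
Variables (P : forall n, probability (T n) R) (eta : forall n, T n -> R).
Arguments eta : clear implicits.
Variables (s : R^nat) (p : R).
Hypotheses (p0 : 0 < p) (s0 : forall n, (0 < n)%N -> 0 < s n).
Hypotheses (sy : s @ \oo --> +oo) (eta0 : forall n w, 0 <= eta n w).
Hypothesis meta : forall n, measurable_fun setT (eta n).
Hypothesis upper : forall x d, 0 < x -> 0 < d -> \forall n \near \oo,
  (P n [set w | (x <= eta n w)%R] <= (expR (- (s n * (x `^ p / p - d))))%:E)%E.
Hypothesis lower : forall x d, 0 <= x -> 0 < d -> \forall n \near \oo,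
  ((expR (- (s n * (x `^ p / p + d))))%:E <= P n [set w | (x < eta n w)%R])%E.

Let borel (G : set R) := <<s [set U : set R | open U] >> G.
Let u G n := ((s n)^-1%:E * lne (P n (eta n @^-1` G)))%E.

Lemma borel_preimage_measurable n G : borel G -> measurable (eta n @^-1` G).
Proof.
move=> bG; rewrite -[X in measurable X]setTI; apply: meta => //.
apply: (smallest_sub _ _ bG); last by move=> U; exact: open_measurable.
exact: sigma_algebra_measurable.
Qed.

Lemma lne_le_expR n (A : set (T n)) (b : R) : (0 < n)%N -> measurable A ->
  (P n A <= (expR (s n * b))%:E)%E ->
  ((s n)^-1%:E * lne (P n A) <= b%:E)%E.
Proof.
move=> n0 mA PA; rewrite lee_pdivrMl ?s0// -EFinM.
have -> : (s n * b)%:E = lne (expR (s n * b))%:E by rewrite lne_EFin ?expR_gt0// expRK.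
rewrite lee_lne ?in_itv/= ?measure_ge0 ?leey//.
by rewrite lee_fin expR_ge0.
Qed.

Lemma expR_le_lne n (A : set (T n)) (b : R) : (0 < n)%N -> measurable A ->
  ((expR (s n * b))%:E <= P n A)%E ->
  (b%:E <= (s n)^-1%:E * lne (P n A))%E.
Proof.
move=> n0 mA PA; rewrite lee_pdivlMl ?s0// -EFinM.
have -> : (s n * b)%:E = lne (expR (s n * b))%:E by rewrite lne_EFin ?expR_gt0// expRK.
rewrite lee_lne ?in_itv/= ?measure_ge0 ?leey//.
by rewrite lee_fin expR_ge0.
Qed.

(** As [eta] is nonnegative, [eta n w] in [G] forces [x <= eta n w], and [upper] applies for every
    [d > 0]. *)
Lemma ldp_upper_avoid G x : borel G -> 0 < x ->
  (forall y, G y -> 0 <= y -> x <= y) ->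
  (limn_esup (u G) <= (- (x `^ p / p))%:E)%E.
Proof.
move=> bG x0 Gx; apply/lee_addgt0Pr => d d_gt0.
apply: limn_esup_le_near; near=> n.
have n0 : (0 < n)%N by near: n; exact: nbhs_infty_gt.
rewrite -EFinD; apply: lne_le_expR => //; first exact: borel_preimage_measurable.
have -> : s n * (- (x `^ p / p) + d) = - (s n * (x `^ p / p - d)) by ring.
apply: (@le_trans _ _ (P n [set w | (x <= eta n w)%R])).
  apply: le_measure; rewrite ?inE.
  - exact: borel_preimage_measurable.
  - rewrite -[X in measurable X]setTI.
    by apply: measurable_fun_ler => //; exact: meta.
  - by move=> w /= Gw; apply: Gx.
by near: n; exact: upper.
Unshelve. all: end_near. Qed.

(** The rate increases on the half-line: if it is at least [r] on [G], the nonnegative points of [G]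
    lie beyond [(p r)^(1/p)]. *)
Lemma ldp_upper G : borel G ->
  (limn_esup (u G) <= - ereal_inf (powR_rate p @` closure G))%E.
Proof.
move=> bG; set m := ereal_inf _.
have m0 : (0 <= m)%E.
  by apply: le_ereal_inf_tmp => _ [y _ <-]; exact: powR_rate_ge0.
have mG y : G y -> (m <= powR_rate p y)%E.
  by move=> Gy; apply: ereal_inf_lbound; exists y => //; exact: subset_closure.
have avoid r : 0 < r -> (r%:E <= m)%E -> (limn_esup (u G) <= (- r)%:E)%E.
  move=> r0 rm; have pr0 : 0 < p * r by rewrite mulr_gt0.
  have -> : r = ((p * r) `^ p^-1) `^ p / p.
    rewrite -powRrM mulVf ?gt_eqF// powRr1 ?(ltW pr0)//.
    by field; rewrite gt_eqF.
  apply: ldp_upper_avoid => //; first by rewrite powR_gt0.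
  move=> y Gy y0; have := le_trans rm (mG _ Gy).
  rewrite /powR_rate y0 lee_fin ler_pdivlMr// [r * p]mulrC => h.
  have -> : y = (y `^ p) `^ p^-1 by rewrite -powRrM divff ?gt_eqF// powRr1.
  by rewrite ge0_ler_powR ?nnegrE ?powR_ge0 ?invr_ge0 ?(ltW p0) ?(ltW pr0).
(* A positive finite infimum is used directly, the value 0 only needs probabilities at most 1, and
   for [+oo] every positive level is available. *)
move: m0 avoid; case: m {mG} => [r m0 avoid|_ avoid|//].
  have [r0|r0] := ltP 0 r; first by rewrite -EFinN avoid.
  have -> : r = 0 by apply/eqP; rewrite eq_le r0 -lee_fin.
  rewrite oppe0; apply: limn_esup_le_near; near=> n.
  apply: lne_le_expR; first by near: n; exact: nbhs_infty_gt.
    exact: borel_preimage_measurable.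
  rewrite mulr0 expR0; apply: probability_le1; exact: borel_preimage_measurable.
rewrite leeNr leye_eq; apply/eqP/eqyP => A A0.
by rewrite leeNr; apply: avoid => //; exact: leey.
Unshelve. all: end_near. Qed.

Lemma ldp_lower G : borel G ->
  (- ereal_inf (powR_rate p @` interior G) <= limn_einf (u G))%E.
Proof.
move=> bG; rewrite leeNl; apply: le_ereal_inf_tmp => _ [x Gx <-].
rewrite leeNl /powR_rate; case: ifPn => x0; last by rewrite leNye.
apply/lee_subgt0Pr => d d_gt0.
(* [G] contains an interval [(a, b)] with [x < a]: its probability is that of
   [eta > a] minus the exponentially smaller one of [eta >= b]. *)
have [b xb bG'] : exists2 b, x < b & forall y, x < y < b -> G y.
  move: Gx => /nbhs_ballP[b /= b0 xbG]; exists (x + b); first by rewrite ltrDl.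
  move=> y /andP[xy yb]; apply: xbG; rewrite /ball/= distrC.
  by rewrite gtr0_norm ?subr_gt0// ltrBlDl.
(* [a] stays below [b] and costs at most [d/2] in rate over [x]. *)
pose B := x `^ p + p * (d / 2); pose a := Num.min (B `^ p^-1) ((x + b) / 2).
have B0 : 0 < B by rewrite ltr_wpDl ?powR_ge0// mulr_gt0// divr_gt0.
have bp : (B `^ p^-1) `^ p = B by rewrite -powRrM mulVf ?gt_eqF// powRr1// ltW.
have xB : x < B `^ p^-1.
  rewrite ltNge; apply/negP => bx.
  have : (B `^ p^-1) `^ p <= x `^ p.
    by rewrite ge0_ler_powR ?nnegrE ?powR_ge0 ?(ltW p0).
  by rewrite bp /B gerDl leNgt mulr_gt0// divr_gt0.
have xa : x < a by rewrite lt_min xB/=; lra.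
have ab : a < b by rewrite gt_min; apply/orP; right; lra.
have a0 : 0 <= a by rewrite (le_trans x0)// ltW.
have aB : a `^ p <= B.
  rewrite -bp ge0_ler_powR ?nnegrE ?powR_ge0 ?(ltW p0)//.
  by rewrite ge_min lexx.
have abp : a `^ p / p < b `^ p / p.
  by rewrite ltr_pM2r ?invr_gt0// gt0_ltr_powR ?nnegrE// (le_trans a0)// ltW.
(* The slack [g] serves both tails: [2 g <= d/2] fits the remaining tolerance, and [3 g] fits the
   gap between the rates at [a] and [b]. *)
pose g := Num.min (d / 4) ((b `^ p / p - a `^ p / p) / 3).
have g0 : 0 < g by rewrite lt_min !divr_gt0// subr_gt0.
have gd : g <= d / 4 by rewrite ge_min lexx.
have gab : a `^ p / p + 2 * g <= b `^ p / p - g.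
  have : g <= (b `^ p / p - a `^ p / p) / 3 by rewrite ge_min lexx orbT.
  lra.
have b0 : 0 < b by rewrite (le_lt_trans a0).
apply: limn_einf_ge_near; near=> n.
have n0 : (0 < n)%N by near: n; exact: nbhs_infty_gt.
have sn0 := s0 n0.
have mgt z : measurable [set w | (z < eta n w)%R].
  rewrite -[X in measurable X]setTI.
  by apply: measurable_fun_ltr => //; exact: meta.
have mge z : measurable [set w | (z <= eta n w)%R].
  rewrite -[X in measurable X]setTI.
  by apply: measurable_fun_ler => //; exact: meta.
have mG := borel_preimage_measurable n bG.
rewrite -EFinN -EFinB; apply: expR_le_lne => //.
have up : (P n [set w | (b <= eta n w)%R] <= (expR (- (s n * (b `^ p / p - g))))%:E)%E.
  by near: n; exact: upper.
have low : ((expR (- (s n * (a `^ p / p + g))))%:E <= P n [set w | (a < eta n w)%R])%E.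
  by near: n; exact: lower.
have split_le : (P n [set w | (a < eta n w)%R] <=
    P n (eta n @^-1` G) + P n [set w | (b <= eta n w)%R])%E.
  apply: (@le_trans _ _ (P n (eta n @^-1` G `|` [set w | (b <= eta n w)%R]))).
    apply: le_measure; rewrite ?inE//; first exact: measurableU.
    move=> w /= aw; have [bw|wb] := leP b (eta n w); [by right|left].
    by apply: bG'; rewrite wb (lt_trans xa).
  exact: measureU2.
have := le_trans low (le_trans split_le (leeD2l _ up)).
rewrite -leeBlDr// -EFinB; apply: le_trans.
rewrite lee_fin.
(* Now [exp(s_n g) >= 2]: the tail at [a] is at least [2 v] and the one at [b] at most [v], for the
   [v] below, so their difference is at least [v]. *)
have sg : ln 2 <= s n * g.
  rewrite -ler_pdivrMr//; near: n.
  by move/cvgryPge : sy; apply.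
set v1 := expR _; set v2 := expR _; set v3 := expR _.
pose v := expR (- (s n * (a `^ p / p + 2 * g))).
have h1 : v1 <= v.
  rewrite ler_expR -[leRHS]mulrN ler_pM2l//.
  have : a `^ p / p <= B / p by rewrite ler_pM2r ?invr_gt0.
  have -> : B / p = x `^ p / p + d / 2 by rewrite /B; field; rewrite gt_eqF.
  lra.
have h3 : v3 <= v by rewrite ler_expR lerN2 ler_pM2l.
have h2 : v * 2 <= v2.
  have -> : v2 = v * expR (s n * g) by rewrite -expRD; congr expR; ring.
  by rewrite ler_wpM2l ?expR_ge0// -[leLHS](@lnK R) ?posrE// ler_expR.
lra.
Unshelve. all: end_near. Qed.

Lemma tails_LDP : LDP P eta s (powR_rate p).
Proof.
split=> //.
- by move=> n G; exact: borel_preimage_measurable.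
- by case: (good_rate_function_powR p0).
move=> G bG; split; [exact: ldp_lower|exact: limn_einf_sup|exact: ldp_upper].
Qed.

End ldp.
End tails_to_ldp.

(** * Growth of the speed and the conclusion for the scaled norm *)

Lemma ldp_speed_cvgy (R : realType) (p : R) : 0 < p ->
  ldp_speed p @ \oo --> +oo.
Proof.
move=> p0; apply/cvgryPge => A; apply: near_powR_ge.
by rewrite divr_gt0 ?addr_gt0 ?mulr_gt0.
Qed.

Lemma ratio_ldp_speed_cvgy (R : realType) (p : R) : 0 < p < 2 ->
  (fun n : nat => n%:R / ldp_speed p n) @ \oo --> +oo.
Proof.
move=> /andP[p0 p2]; apply/cvgryPge => A; near=> n.
have n0 : (0 < n)%N by near: n; exact: nbhs_infty_gt.
have n0' : 0 < n%:R :> R by rewrite ltr0n.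
have -> : n%:R / ldp_speed p n = n%:R `^ ((2 - p) / (2 + p)).
  rewrite -[n%:R in LHS]powRr1 ?(ltW n0')// -powRN -powRD_gt0//.
  by congr (_ `^ _); field; rewrite gt_eqF// addr_gt0.
near: n; apply: near_powR_ge.
by rewrite divr_gt0 ?subr_gt0 ?addr_gt0.
Unshelve. all: end_near. Qed.

Theorem proposition3p3 (R : realType) (p : R) (hp : 1 <= p < 2)
    (d : nat -> measure_display) (T : forall n : nat, measurableType (d n))
    (P : forall n : nat, probability (T n) R)
    (X : forall n : nat, {RV (P n) >-> n.-tuple (measurableTypeR R)})
    (hX : forall n : nat, (0 < n)%N ->
       uniform_on (X n) (dilate (n%:R `^ p^-1) (lp_ball p n))) :
  let s : R^nat := fun n => n%:R `^ (2 * p / (2 + p)) in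
  let J : R -> \bar R := fun x => if 0 <= x then (x `^ p / p)%:E else +oo%E in
  [/\ s @ \oo --> +oo,
      (fun n : nat => n%:R / s n) @ \oo --> +oo,
      good_rate_function J &
      @LDP R R d T P (fun n w => Num.sqrt (s n) * norm2 (X n w) / n%:R) s J].
Proof.
move=> s J; have /andP[p1 p2] := hp.
have p0 : 0 < p by exact: lt_le_trans p1.
have sy : s @ \oo --> +oo by exact: ldp_speed_cvgy.
(* Uniformity turns probabilities into volume ratios on [{N <= n}]. *)
have PX n (A : set (n.-tuple (measurableTypeR R))) : (0 < n)%N -> measurable A ->
    P n (X n @^-1` A) = (lebesgue_tuple n (A `&` [set t | lp_sum p t <= n%:R]%R) /
      lp_vol p n n%:R)%E.
  by move=> n0 mA; rewrite /lp_vol -dilate_lp_ball//; exact: hX.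
(* Since [sqrt(s_n)/n = 1/ldp_scale p n], a threshold [x] becomes [x * ldp_scale p n] for the norm
   itself. *)
have etaE n w : (0 < n)%N -> Num.sqrt (s n) * norm2 (X n w) / n%:R =
    norm2 (X n w) / ldp_scale p n.
  by move=> n0; rewrite mulrAC (sqrt_ldp_speed p0 n0) mulrC.
split => //.
- by apply: ratio_ldp_speed_cvgy; rewrite p0.
- exact: good_rate_function_powR.
apply: tails_LDP => //.
- by move=> n n0; exact: ldp_speed_gt0.
- by move=> n w; rewrite divr_ge0 ?mulr_ge0 ?sqrtr_ge0 ?norm2_ge0.
- move=> n; apply: measurable_funM => //; apply: measurable_funM => //.
  by apply: measurableT_comp => //; exact: measurable_norm2.
- move=> x e x0 e0; near=> n.
  have n0 : (0 < n)%N by near: n; exact: nbhs_infty_gt.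
  have -> : [set w | x <= Num.sqrt (s n) * norm2 (X n w) / n%:R] =
      X n @^-1` [set t | x * ldp_scale p n <= norm2 t].
    by apply/seteqP; split=> w /=; rewrite etaE// ler_pdivlMr// ldp_scale_gt0.
  rewrite PX//; last first.
    rewrite -[X in measurable X]setTI.
    by apply: measurable_fun_ler => //; exact: measurable_norm2.
  by near: n; exact: lp_ball_upper_rate.
- move=> x e x0 e0; near=> n.
  have n0 : (0 < n)%N by near: n; exact: nbhs_infty_gt.
  have -> : [set w | x < Num.sqrt (s n) * norm2 (X n w) / n%:R] =
      X n @^-1` [set t | x * ldp_scale p n < norm2 t].
    by apply/seteqP; split=> w /=; rewrite etaE// ltr_pdivlMr// ldp_scale_gt0.
  rewrite PX//; last first.
    rewrite -[X in measurable X]setTI.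
    by apply: measurable_fun_ltr => //; exact: measurable_norm2.
  by near: n; exact: lp_ball_lower_rate.
Unshelve. all: end_near. Qed.
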